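(* Let $p \in \mathbb{C}[z_1,\dots,z_d]$ be a pure stable polynomial with $p(0)=0$, with homogeneous expansion $p=\sum_{j\ge M} P_j$, where $P_j$ is homogeneous of degree $j$ and $P_M\not\equiv 0$. Suppose (as can always be arranged by replacing $p$ with a unimodular constant multiple) that $P_M$ has real coefficients. Let $A=\tfrac12(p+\bar p)$ and $B=\tfrac1{2i}(p-\bar p)$. Then the lowest order nonzero homogeneous term of $A$ equals $P_M$, and $B$ vanishes to order exactly $M+1$ at $0$.
   Context: $\mathbb{H}=\{z\in\mathbb{C}:\operatorname{Im} z>0\}$. For a polynomial $p$, $\bar p(z)=\overline{p(\bar z_1,\dots,\bar z_d)}$ (coefficients conjugated). A polynomial $p\in\mathbb{C}[z_1,\dots,z_d]$ is pure stable if it has no zeros in $\mathbb{H}^d$ and has no nonconstant factor in common with $\bar p$. Thus $A,B$ have real coefficients and $p=A+iB$. *)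

(* Defs.v *)
From HB Require Import structures.
From mathcomp Require Import all_boot all_order all_algebra.
From mathcomp Require Import reals.
From mathcomp Require Export complex mpoly.

Set Implicit Arguments.
Unset Strict Implicit.
Unset Printing Implicit Defensive.

Import Order.TTheory GRing.Theory Num.Theory.
Local Open Scope ring_scope.

Section PureStable.
Context {R : realType} {d : nat}.
Implicit Types (p q : {mpoly R[i][d]}) (m : nat).

Definition mconj p : {mpoly R[i][d]} := map_mpoly (@conjc R) p.

(* complex.Im is the R-valued projection, unlike the algebraic 'Im of numClosedFieldType. *)
Definition in_upper_half_space (z : 'I_d -> R[i]) : Prop :=
  forall i, 0 < complex.Im (z i).

Definition mdivides q p : Prop := exists r, p = q * r.

Definition mconstant p : Prop := exists c : R[i], p = c%:MP.

Definition pure_stable p : Prop :=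
  (forall z, in_upper_half_space z -> p.@[z] != 0) /\
  (forall q, mdivides q p -> mdivides q (mconj p) -> mconstant q).

Definition has_real_coefficients p : Prop :=
  forall mon : 'X_{1..d}, complex.Im p@_mon = 0.

Definition homog_part m p : {mpoly R[i][d]} := pihomog mdeg m p.

(* p vanishes at 0 to order exactly m; no m qualifies for the zero polynomial. *)
Definition vanishes_to_order p m : Prop :=
  (forall j, (j < m)%N -> homog_part j p = 0) /\ homog_part m p != 0.

Definition is_lowest_term p q : Prop :=
  exists m, vanishes_to_order p m /\ q = homog_part m p.

Definition mreal_part p : {mpoly R[i][d]} := 2^-1 *: (p + mconj p).

Definition mimag_part p : {mpoly R[i][d]} := (2 * 'i%C)^-1 *: (p - mconj p).

Lemma meval_mconj p (z : 'I_d -> R[i]) :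
  (mconj p).@[z] = conjc (p.@[fun i => conjc (z i)]).
Proof.
elim/mpolyind: p => [|c m p _ _ IH]; first by rewrite /mconj !raddf0.
rewrite /mconj raddfD /= !mevalD map_mpolyZ map_mpolyX !mevalZ !mevalX.
rewrite [in LHS]IH rmorphD rmorphM rmorph_prod; congr (_ * _ + _).
by apply: eq_bigr => i _; rewrite rmorphXn /= conjcK.
Qed.

Lemma mreal_imag_partE p : p = mreal_part p + 'i%C *: mimag_part p.
Proof.
have i0 : 'i%C != 0 :> R[i] by rewrite eq_complex /= oner_eq0 andbF.
apply/mpolyP => m; rewrite mcoeffD !mcoeffZ mcoeffD mcoeffB.
rewrite mulrA invfM mulrCA divff // mulr1 -mulrDr addrACA subrr addr0 -mulr2n.
by rewrite -[p@_m *+ 2]mulr_natl mulKf // pnatr_eq0.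
Qed.

End PureStable.

(* Main.v *)
(* On a line [t |-> x + t y] with [y > 0] the roots of a stable [p] lie in the
   closed lower half-plane, so [|pbar| <= |p|] on [H^d]. By scaling this passes to
   [Q := P_M], and replacing [z] by [-zbar] turns it into [|Qbar| = |Q|] on [H^d];
   polarizing [Q(z) conj(Q(z)) = Qbar(z) conj(Qbar(z))] makes [Qbar] a unimodular
   multiple of [Q].
   If [Q] and [P_(M+1)] are both real, then for [y > 0] with [Q(y) != 0] the ratio
   [P_(M+1)(y) / Q(y)] of the two lowest coefficients of [t |-> p(t y)] is minus the
   sum of the inverses of its nonzero roots. Their imaginary parts have the same
   sign, so all the roots are real and [pbar(y) = p(y)]. Hence [(pbar - p) Q = 0]
   and [pbar = p], which contradicts purity. *)
Require Import Defs.
From mathcomp Require Import all_boot all_order all_algebra.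
From mathcomp Require Import reals ring lra.
Import Order.TTheory GRing.Theory Num.Theory.
Local Open Scope ring_scope.

(** * Polynomials that vanish at all positive points *)

Lemma poly_eq0_pos (F : numDomainType) (f : {poly F}) :
  (forall s, 0 < s -> f.[s] = 0) -> f = 0.
Proof.
move=> f0; pose rs := [seq k.+1%:R : F | k <- iota 0 (size f)].
apply: (@roots_geq_poly_eq0 _ f rs); last by rewrite size_map size_iota.
- by apply/allP => _ /mapP[k _ ->]; rewrite rootE f0 ?ltr0Sn.
- rewrite map_inj_uniq ?iota_uniq // => i j /eqP.
  by rewrite eqr_nat => /eqP[].
Qed.

(** Reduction modulo [N] isolates the lowest digit, and cancelling [N] leaves the others to the
    induction. Distinct monomials thus get distinct exponents under Kronecker substitution. *)
Lemma base_expansion_inj (N n : nat) (a b : 'I_n -> nat) :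
  (forall i, a i < N)%N -> (forall i, b i < N)%N ->
  (\sum_(i < n) N ^ i * a i = \sum_(i < n) N ^ i * b i)%N -> a =1 b.
Proof.
elim: n a b => [|n IH] a b aN bN; first by move=> _ [].
rewrite !big_ord_recl !expn0 !mul1n.
under eq_bigr do rewrite /= expnS -mulnA.
under [in RHS]eq_bigr do rewrite /= expnS -mulnA.
rewrite -!big_distrr /= ![(N * _)%N]mulnC => e.
have e0 : a ord0 = b ord0.
  have := congr1 (modn^~ N) e.
  by rewrite /= ![(_ + _ * N)%N]addnC !modnMDl !modn_small.
have N0 : (0 < N)%N by apply: leq_ltn_trans (aN ord0).
move: e; rewrite e0 => /addnI/eqP; rewrite eqn_pmul2r // => /eqP e.
have aE := IH _ _ (fun i => aN (lift ord0 i)) (fun i => bN (lift ord0 i)) e.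
by move=> i; case: (unliftP ord0 i) => [j|] ->.
Qed.

Lemma horner_mmap (F : comNzRingType) n (h : 'I_n -> {poly F}) p t :
  (mmap polyC h p).[t] = p.@[fun i => (h i).[t]].
Proof.
elim/mpolyind: p => [|c m p _ _ IH]; first by rewrite !raddf0 horner0.
rewrite raddfD /= hornerD IH mmapZ mmapX hornerM hornerC mevalD mevalZ mevalX.
congr (_ * _ + _); rewrite /mmap1 horner_prod.
by apply: eq_bigr => i _; rewrite horner_exp.
Qed.

(* Kronecker substitution [v_i = t^(N^i)] with [N] larger than all exponents. *)
Lemma mpoly_eq0_pos (F : numDomainType) n (p : {mpoly F[n]}) :
  (forall v, (forall i, 0 < v i) -> p.@[v] = 0) -> p = 0.
Proof.
move=> p0; pose N := msize p; pose e (m : 'X_{1..n}) := (\sum_(i < n) N ^ i * m i)%N.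
pose f := mmap polyC (fun i : 'I_n => 'X^(N ^ i)) p : {poly F}.
have f0 : f = 0.
  apply: poly_eq0_pos => s s0; rewrite horner_mmap; apply: p0 => i.
  by rewrite hornerXn exprn_gt0.
have fE : f = \sum_(m <- msupp p) p@_m *: 'X^(e m).
  rewrite /f /mmap; apply: eq_bigr => m _; rewrite mul_polyC /mmap1 /e.
  congr (_ *: _); rewrite -prodrXr; apply: eq_bigr => i _.
  by rewrite exprM.
have lt_supp m : m \in msupp p -> forall i, (m i < N)%N.
  move=> mp i; apply: leq_ltn_trans (msize_mdeg_lt mp).
  by rewrite mdegE (bigD1 i) //= leq_addr.
apply/mpolyP => m; rewrite mcoeff0.
case: (boolP (m \in msupp p)) => [mp|]; last exact: memN_msupp_eq0.
have := congr1 (fun g : {poly F} => g`_(e m)) f0; rewrite fE coef0 coef_sum /=.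
rewrite (bigD1_seq m) ?msupp_uniq //= coefZ coefXn eqxx mulr1.
rewrite big_seq_cond big1 ?addr0 // => m' /andP[m'p ne].
rewrite coefZ coefXn; case: eqP => [E|]; last by rewrite mulr0.
case/eqP: ne; apply/mnmP => i.
by apply: (base_expansion_inj N _ m' m _ _ _ i) => //; exact: lt_supp.
Qed.

(** * One-variable polynomials without zeros in the upper half-plane *)

Section Univariate.
Context {R : rcfType}.
Implicit Types (f g : {poly R[i]}) (t a : R[i]).
Local Notation C := R[i].

Definition half_plane_stable f := forall t, 0 < complex.Im t -> f.[t] != 0.

(** With [y = Im t] and [v = Im a] the squared moduli differ by [-4 y v], which is nonnegative. *)
Lemma norm_subJ_le t a : 0 < complex.Im t -> complex.Im a <= 0 ->
  `|t - conjc a| <= `|t - a|.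
Proof.
case: t a => [x y] [u v] /= y0 v0.
rewrite !normc_def lecR /= ler_wsqrtr // lerD2l opprK.
have := mulr_ge0_le0 (ltW y0) v0; nra.
Qed.

(** Conjugating the coefficients conjugates the roots, which lie in the closed lower half-plane, so
    the bound holds factor by factor. *)
Lemma half_plane_stable_normJ f t : half_plane_stable f -> 0 < complex.Im t ->
  `|(map_poly (@conjc R) f).[t]| <= `|f.[t]|.
Proof.
move=> fs t0; have [s fE] := closed_field_poly_normal f.
have f0 : lead_coef f != 0.
  by rewrite lead_coef_eq0; apply: contraNneq (fs t t0) => ->; rewrite horner0.
have s_le a : a \in s -> complex.Im a <= 0.
  move=> sa; rewrite leNgt; apply/negP => /fs.
  by rewrite fE -rootE rootZ ?root_prod_XsubC ?sa.
rewrite fE map_polyZ rmorph_prod /= !hornerZ !normrM normcJ.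
apply: ler_wpM2l => //; rewrite !horner_prod !normr_prod big_seq [leRHS]big_seq.
apply: ler_prod => a sa; rewrite normr_ge0 rmorphB /= map_polyX map_polyC /=.
by rewrite !hornerXsubC norm_subJ_le ?s_le.
Qed.

(** This Lipschitz bound at 0 stands in for continuity. In the order of [R[i]], [0 < s] forces [s]
    to be real. *)
Lemma norm_horner_sub_le f : exists2 K : C, 0 <= K &
  forall s, 0 < s <= 1 -> `|f.[s] - f.[0]| <= K * s.
Proof.
elim/poly_ind: f => [|f c [K K0 IH]].
  by exists 0 => // s _; rewrite !horner0 subrr normr0 mul0r.
exists (`|f.[0]| + K) => [|s /[dup] s01 /andP[s0 s1]]; first by rewrite addr_ge0.
rewrite !hornerMXaddC mulr0 add0r addrK normrM (gtr0_norm s0).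
rewrite ler_wpM2r ?(ltW s0) // -[f.[s]](subrK f.[0]) (le_trans (ler_normD _ _)) //.
by rewrite addrC lerD2l (le_trans (IH s s01)) // ler_piMr.
Qed.

Lemma drop_polyK M f :
  (forall j, (j < M)%N -> f`_j = 0) -> f = drop_poly M f * 'X^M.
Proof.
move=> f0; rewrite -[LHS](poly_take_drop M) -[RHS]add0r; congr (_ + _).
by apply/polyP => j; rewrite coef_take_poly coef0; case: ltnP => // /f0.
Qed.

(** Divide both values by [s ^+ M] and let [s] tend to 0. *)
Lemma norm_coef_le f g M :
  (forall j, (j < M)%N -> f`_j = 0) -> (forall j, (j < M)%N -> g`_j = 0) ->
  (forall s, 0 < s -> `|g.[s]| <= `|f.[s]|) -> `|g`_M| <= `|f`_M|.
Proof.
have drop0 (h : {poly C}) : h`_M = (drop_poly M h).[0].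
  by rewrite horner_coef0 coef_drop_poly add0n.
move=> /drop_polyK fE /drop_polyK gE le_gf; rewrite !drop0.
set f' := drop_poly M f in fE *; set g' := drop_poly M g in gE *.
have {}le_gf s : 0 < s -> `|g'.[s]| <= `|f'.[s]|.
  move=> s0; have := le_gf s s0; rewrite fE gE !hornerM !hornerXn !normrM.
  by rewrite ler_pM2r // normr_gt0 expf_neq0 ?gt_eqF.
have [K K0 fK] := norm_horner_sub_le f'; have [L L0 gL] := norm_horner_sub_le g'.
apply/ler_addgt0Pl => e e0; have KL0 : 0 <= K + L by rewrite addr_ge0.
have D0 : 0 < e + (K + L) by rewrite ltr_pwDl.
(* This choice gives [s <= 1] and [(K + L) * s <= e]; the denominator is positive even when
   [K = L = 0]. *)
pose s := e / (e + (K + L)).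
have s0 : 0 < s by rewrite divr_gt0.
have s01 : 0 < s <= 1 by rewrite s0 ler_pdivrMr // mul1r lerDl.
have KLs : (K + L) * s <= e.
  by rewrite mulrCA ler_piMr ?(ltW e0) // ler_pdivrMr // mul1r lerDr ltW.
have g's : `|g'.[0]| <= L * s + `|g'.[s]|.
  have := le_trans (ler_normD (g'.[0] - g'.[s]) g'.[s]) _; rewrite subrK; apply.
  by rewrite lerD2r distrC gL.
have f's : `|f'.[s]| <= K * s + `|f'.[0]|.
  have := le_trans (ler_normD (f'.[s] - f'.[0]) f'.[0]) _; rewrite subrK; apply.
  by rewrite lerD2r fK.
apply: (le_trans g's); apply: (le_trans (lerD (lexx _) (le_trans (le_gf s s0) f's))).
by rewrite addrA lerD2r -mulrDl addrC.
Qed.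

Lemma coef01_prod_1subZX (s : seq C) :
  (\prod_(b <- s) (1 - b *: 'X))`_0 = 1 /\
  (\prod_(b <- s) (1 - b *: 'X))`_1 = - \sum_(b <- s) b.
Proof.
elim: s => [|b s [IH0 IH1]]; first by rewrite !big_nil coef1 oppr0 coef1.
rewrite !big_cons mulrBl mul1r -scalerAl !coefB !coefZ !coefXM /= IH0 IH1.
by rewrite mulr0 mulr1 subr0 opprD addrC.
Qed.

Lemma conjc_idP (a : C) : reflect (conjc a = a) (complex.Im a == 0).
Proof.
case: a => x y /=; apply: (iffP eqP) => [->|[/eqP]]; first by rewrite oppr0.
by rewrite eqNr => /eqP.
Qed.

Lemma Im_sum (I : Type) (s : seq I) (F : I -> C) :
  complex.Im (\sum_(i <- s) F i) = \sum_(i <- s) complex.Im (F i).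
Proof. by apply: (big_morph (@complex.Im R)) => // -[? ?] [? ?]. Qed.

Lemma Im_inv_ge0 (a : C) : complex.Im a <= 0 -> 0 <= complex.Im a^-1.
Proof.
case: a => x y /= y0; rewrite -mulNr mulr_ge0 ?oppr_ge0 // invr_ge0.
by rewrite addr_ge0 ?sqr_ge0.
Qed.

(* Up to a real factor, [f = 'X^M * \prod_b (1 - b 'X)] where [b] runs over the
   inverses of the nonzero roots, so that [0 <= Im b]; the coefficient of
   ['X^M.+1] being real means [\sum_b Im b = 0]. *)
Lemma half_plane_stable_real f M :
  half_plane_stable f -> (forall j, (j < M)%N -> f`_j = 0) -> f`_M != 0 ->
  complex.Im f`_M = 0 -> complex.Im f`_M.+1 = 0 -> map_poly (@conjc R) f = f.
Proof.
move=> fs /drop_polyK fE fM0 /eqP/conjc_idP fMr /eqP/conjc_idP fM1r.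
set h := drop_poly M f in fE.
have h0E : f`_M = h`_0 by rewrite coef_drop_poly.
have h1E : f`_M.+1 = h`_1 by rewrite coef_drop_poly.
rewrite h0E in fM0 fMr; rewrite h1E in fM1r.
have [r hE] := closed_field_poly_normal h.
have root_h a : a \in r -> root h a.
  move=> ra; rewrite hE rootZ ?root_prod_XsubC // lead_coef_eq0.
  by apply: contraNneq fM0 => ->; rewrite coef0.
have r0 a : a \in r -> a != 0.
  by move=> /root_h; apply: contraTneq => ->; rewrite rootE horner_coef0.
have r_le a : a \in r -> complex.Im a <= 0.
  move=> ra; rewrite leNgt; apply/negP => /fs.
  by rewrite fE hornerM (rootP (root_h a ra)) mul0r eqxx.
pose s := [seq a^-1 | a <- r]; pose g := \prod_(b <- s) (1 - b *: 'X).
have [g0 g1] := coef01_prod_1subZX s; rewrite -/g in g0 g1.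
have {hE} hE : h = h`_0 *: g.
  (* Each factor ['X - a] is [- a] times [1 - a^-1 *: 'X]. The total scalar is then identified
     through the constant coefficient 1 of [g]. *)
  have {}hE : h = (lead_coef h * \prod_(a <- r) - a) *: g.
    rewrite {1}hE -scalerA; congr (_ *: _); rewrite /g /s big_map.
    rewrite -mul_polyC rmorph_prod -big_split /=.
    rewrite big_seq [RHS]big_seq; apply: eq_bigr => a /r0 a0.
    rewrite mul_polyC scalerBr scalerA mulNr divff // scaleN1r opprK addrC.  by rewrite -polyCN -alg_polyC scaleNr.
  by rewrite {2}hE coefZ g0 mulr1.
have s_ge b : b \in s -> 0 <= complex.Im b.
  by move=> /mapP[a /r_le a_le ->]; apply: Im_inv_ge0.
have : conjc (\sum_(b <- s) b) = \sum_(b <- s) b.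
  have -> : \sum_(b <- s) b = - (h`_1 / h`_0).
    by rewrite hE !coefZ g0 g1 mulr1 mulrC mulKf // opprK.
  by rewrite rmorphN fmorph_div /= fM1r fMr.
move=> /conjc_idP; rewrite Im_sum big_seq psumr_eq0 // => /allP s_real.
rewrite fE hE rmorphM /= map_polyZ map_polyXn; congr (_ *: _ * _); first exact: fMr.
rewrite /g rmorph_prod big_seq [RHS]big_seq; apply: eq_bigr => b bs.
rewrite rmorphB rmorph1 /= map_polyZ map_polyX; congr (_ - _ *: _).
by apply/conjc_idP; have := s_real b bs; rewrite bs.
Qed.
End Univariate.

(** * Homogeneous parts and restriction to lines through the origin *)

Section Multivariate.
Context {R : realType} {d : nat}.
Local Notation C := R[i].
Implicit Types (p q : {mpoly C[d]}) (z v x y : 'I_d -> C).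

Lemma mcoeff_mconj p m : (mconj p)@_m = conjc p@_m.
Proof. by rewrite /mconj mcoeff_map_mpoly. Qed.

Lemma mconjZ c p : mconj (c *: p) = conjc c *: mconj p.
Proof. by apply/mpolyP => m; rewrite !(mcoeff_mconj, mcoeffZ) rmorphM. Qed.

Lemma mcoeff_homog_part j p m :
  (homog_part j p)@_m = if mdeg m == j then p@_m else 0.
Proof.
elim/mpolyind: p => [|c n p _ _ IH]; first by rewrite /homog_part raddf0 !mcoeff0 if_same.
rewrite /homog_part linearP /= mcoeffD !mcoeffZ mcoeffD mcoeffZ mcoeffX.
rewrite pihomogX [X in _ + X]IH; case: (eqVneq n m) => [->|ne].
  by case: ifP => _; rewrite ?mcoeffX ?eqxx ?mcoeff0 ?mulr0 ?addr0.
by case: (mdeg n == j); rewrite ?mcoeffX ?(negPf ne) ?mcoeff0 mulr0 !add0r.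
Qed.

Lemma homog_part_mconj j p : homog_part j (mconj p) = mconj (homog_part j p).
Proof.
apply/mpolyP => m; rewrite mcoeff_mconj !mcoeff_homog_part mcoeff_mconj.
by case: ifP; rewrite ?rmorph0.
Qed.

Lemma homog_partZ j c p : homog_part j (c *: p) = c *: homog_part j p.
Proof. exact: linearZ. Qed.

Lemma meval_homog_part_scale j p s z :
  (homog_part j p).@[fun i => s * z i] = s ^+ j * (homog_part j p).@[z].
Proof.
elim/mpolyind: p => [|c m p _ _ IH]; first by rewrite /homog_part pihomog0 !meval0 mulr0.
rewrite /homog_part linearP /= mevalD mevalZ IH mevalD mevalZ mulrDr.
congr (_ + _); rewrite pihomogX; case: eqP => [<-|_]; last by rewrite !meval0 !mulr0.
rewrite !mevalX [RHS]mulrCA; congr (_ * _). rewrite /= mdegE -prodrXr -big_split /=.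
by apply: eq_bigr => i _; rewrite exprMn.
Qed.

(** On the line [t |-> t z] a monomial of degree [j] picks up exactly [t^j]. Homogeneous parts
    thereby become one-variable coefficients. *)
Lemma coef_mmap_line j p z :
  (mmap polyC (fun i => z i *: 'X) p)`_j = (homog_part j p).@[z].
Proof.
elim/mpolyind: p => [|c m p _ _ IH]; first by rewrite /homog_part pihomog0 meval0 mmap0 coef0.
rewrite raddfD /= coefD IH mmapZ mmapX /homog_part linearP /= mevalD mevalZ.
congr (_ + _); rewrite coefCM; congr (_ * _).
have -> : mmap1 (fun i => z i *: 'X) m = (\prod_i z i ^+ m i) *: 'X^(mdeg m) :> {poly C}.
  rewrite /mmap1 mdegE -prodrXr -mul_polyC rmorph_prod -big_split /=.
  by apply: eq_bigr => i _; rewrite exprZn mul_polyC.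
rewrite coefZ coefXn pihomogX eq_sym.
by case: eqP => _; rewrite ?mevalX ?meval0 ?mulr1 ?mulr0.
Qed.

Lemma map_conjc_mmap (h : 'I_d -> {poly C}) p :
  map_poly (@conjc R) (mmap polyC h p) =
  mmap polyC (fun i => map_poly (@conjc R) (h i)) (mconj p).
Proof.
elim/mpolyind: p => [|c m p _ _ IH]; first by rewrite /mconj !raddf0.
rewrite /mconj !raddfD /= [X in _ + X]IH map_mpolyZ map_mpolyX !mmapZ !mmapX.
congr (_ + _); rewrite rmorphM /= map_polyC /mmap1 rmorph_prod; congr (_ * _).
by apply: eq_bigr => i _; rewrite rmorphXn.
Qed.

(** * Comparison of [p] with its conjugate on the upper half-space *)

Definition half_space_stable p :=
  forall z, in_upper_half_space z -> p.@[z] != 0.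

Lemma half_space_stable_normJ p z : half_space_stable p ->
  in_upper_half_space z -> `|(mconj p).@[z]| <= `|p.@[z]|.
Proof.
(* The line [t |-> Re z + t Im z] has real coefficients, so conjugation fixes it; it maps the upper
   half-plane into [H^d] and passes through [z] at [t = i]. *)
move=> ps z0; pose h i : {poly C} :=
  ((complex.Re (z i))%:C)%C%:P + ((complex.Im (z i))%:C)%C *: 'X.
have hJ i : map_poly (@conjc R) (h i) = h i.
  rewrite /h rmorphD /= map_polyC map_polyZ map_polyX.
  by congr (_%:P + _ *: _); apply: conjc_real.
have hi i : (h i).['i%C] = z i.
  by rewrite !hornerE mulrC -complexE.
have fs : half_plane_stable (mmap polyC h p).
  move=> t t0; rewrite horner_mmap; apply: ps => i; rewrite !hornerE /=.
  by case: t t0 => u v /= v0; rewrite mul0r !add0r addr0 mulr_gt0.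
have := half_plane_stable_normJ _ 'i%C fs ltr01.
rewrite map_conjc_mmap !horner_mmap.
by rewrite (meval_eq _ (v2 := z)) ?(meval_eq p (v2 := z)) // => i; rewrite hJ.
Qed.

Lemma mmap_line_stable p y : half_space_stable p -> (forall i, 0 < y i) ->
  half_plane_stable (mmap polyC (fun i => y i *: 'X) p).
Proof.
move=> ps y0 t t0; rewrite horner_mmap; apply: ps => i; rewrite !hornerE.
case: (y i) (y0 i) t t0 => a b; rewrite ltcE /= => /andP[/eqP-> a0] [u v] /= v0.
by rewrite mul0r addr0 mulr_gt0.
Qed.

Lemma upper_half_space_scale z (s : C) :
  0 < s -> in_upper_half_space z -> in_upper_half_space (fun i => s * z i).
Proof.
case: s => a b; rewrite ltcE /= => /andP[/eqP-> a0] z0 i.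
by case: (z i) (z0 i) => u v /= v0; rewrite mul0r addr0 mulr_gt0.
Qed.

(** The ray [s z] with [s > 0] stays in [H^d], so the bound between [pbar(s z)] and [p(s z)] passes
    to their coefficients of [s^M]. *)
Lemma lowest_part_norm_le p M z : half_space_stable p ->
    (forall j, (j < M)%N -> homog_part j p = 0) -> in_upper_half_space z ->
  `|(mconj (homog_part M p)).@[z]| <= `|(homog_part M p).@[z]|.
Proof.
move=> ps p_lt z0; rewrite -homog_part_mconj -!coef_mmap_line.
apply: norm_coef_le => [j /p_lt|j /p_lt|s s0].
- by rewrite coef_mmap_line => ->; rewrite meval0.
- by rewrite coef_mmap_line homog_part_mconj => ->; rewrite /mconj raddf0 meval0.
have sz := upper_half_space_scale z s s0 z0.
have E q : (mmap polyC (fun i => z i *: 'X) q).[s] = q.@[fun i => s * z i].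
  by rewrite horner_mmap; apply: meval_eq => i; rewrite !hornerE mulrC.
by rewrite !E; apply: half_space_stable_normJ.
Qed.

(* The reverse inequality is the previous one at [- conjc z]. *)
Lemma lowest_part_norm_eq p M z : half_space_stable p ->
    (forall j, (j < M)%N -> homog_part j p = 0) -> in_upper_half_space z ->
  `|(mconj (homog_part M p)).@[z]| = `|(homog_part M p).@[z]|.
Proof.
move=> ps p_lt z0; apply/le_anti/andP; split; first exact: lowest_part_norm_le.
(* Writing the sign as the scalar [-1] lets homogeneity pull it out as [(-1)^M], of modulus 1. *)
pose w i := -1 * conjc (z i).
have w0 : in_upper_half_space w.
  by move=> i; rewrite /w mulN1r; case: (z i) (z0 i) => u v /=; rewrite opprK.
have := lowest_part_norm_le p M w ps p_lt w0.
rewrite -homog_part_mconj !meval_homog_part_scale !normrM normrX normrN1 expr1n !mul1r.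
rewrite homog_part_mconj !meval_mconj !normcJ.
rewrite (meval_eq _ (v2 := z)) // => i; exact: conjcK.
Qed.

(** * Polarization of the modulus identity *)

Lemma affine_mpoly p (a : 'I_d -> C) (b : C) :
  exists q, forall v, q.@[v] = p.@[fun i => a i + b * v i].
Proof.
exists (p \mPo [tuple (a i)%:MP + b *: 'X_i | i < d]) => v.
rewrite comp_mpoly_meval; apply: meval_eq => i.
by rewrite tnth_mktuple mevalD mevalC mevalZ mevalXU.
Qed.

(** Both sides are polynomials in [y], so agreement at positive points is agreement everywhere. *)
Lemma cross_affine_eq0 p q (a a' : 'I_d -> C) (b b' : C) :
    (forall y, (forall i, 0 < y i) ->
      p.@[fun i => a i + b * y i] * q.@[fun i => a' i + b' * y i] =
      q.@[fun i => a i + b * y i] * p.@[fun i => a' i + b' * y i]) ->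
  forall y, p.@[fun i => a i + b * y i] * q.@[fun i => a' i + b' * y i] =
            q.@[fun i => a i + b * y i] * p.@[fun i => a' i + b' * y i].
Proof.
move=> eq0; have [p1 p1E] := affine_mpoly p a b; have [q1 q1E] := affine_mpoly q a b.
have [p2 p2E] := affine_mpoly p a' b'; have [q2 q2E] := affine_mpoly q a' b'.
have E : p1 * q2 - q1 * p2 = 0.
  apply: mpoly_eq0_pos => v v0.
  by rewrite mevalB !mevalM p1E q1E p2E q2E eq0 ?subrr.
move=> y; apply/eqP; rewrite -subr_eq0 -p1E -q1E -p2E -q2E -!mevalM -mevalB.
by rewrite E meval0.
Qed.

(* [q (x + iy) qbar (x - iy) = qbar (x + iy) q (x - iy)] for positive [x] and [y],
   hence for all complex [x] and [y]. *)
Lemma norm_conj_eq_cross q :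
  (forall z, in_upper_half_space z -> `|(mconj q).@[z]| = `|q.@[z]|) ->
  forall u v, q.@[u] * (mconj q).@[v] = (mconj q).@[u] * q.@[v].
Proof.
move=> q_norm.
have crossH x y : (forall i, 0 < x i) -> (forall i, 0 < y i) ->
    q.@[fun i => x i + 'i%C * y i] * (mconj q).@[fun i => x i + - 'i%C * y i] =
    (mconj q).@[fun i => x i + 'i%C * y i] * q.@[fun i => x i + - 'i%C * y i].
  move=> x0 y0; set z := fun i => x i + 'i%C * y i.
  have z0 : in_upper_half_space z.
    move=> i; rewrite /z; move: (x0 i) (y0 i); case: (x i) (y i) => [a b] [u v].
    rewrite !ltcE /= => /andP[/eqP-> _] /andP[/eqP-> u0].
    by rewrite mul0r !add0r mul1r.
  (* For positive [x] and [y] the second argument is [conjc z], so the two sides are the squared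
     moduli of [q] and [mconj q] at [z]. *)
  have zJ i : x i + - 'i%C * y i = conjc (z i).
    rewrite /z; move: (x0 i) (y0 i); case: (x i) (y i) => [a b] [u v].
    rewrite !ltcE /= => /andP[/eqP-> _] /andP[/eqP-> u0].
    by simpc.
  rewrite (meval_eq q zJ) (meval_eq (mconj q) zJ).
  have -> : (mconj q).@[fun i => conjc (z i)] = conjc q.@[z].
    by rewrite meval_mconj; congr conjc; apply: meval_eq => i; rewrite conjcK.
  have -> : q.@[fun i => conjc (z i)] = conjc (mconj q).@[z].
    by rewrite meval_mconj conjcK.
  by rewrite -!sqr_normc q_norm.
have cross x y :
    q.@[fun i => x i + 'i%C * y i] * (mconj q).@[fun i => x i + - 'i%C * y i] =
    (mconj q).@[fun i => x i + 'i%C * y i] * q.@[fun i => x i + - 'i%C * y i].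
  move: y; apply: (cross_affine_eq0 q (mconj q) x x 'i%C (- 'i%C)) => y y0.
  (* With [y] now positive, exchanging the summands makes [x] the variable, with slope 1, so the
     same lemma reduces [x] to positive points too. *)
  have swap b w i : w i + b * y i = b * y i + 1 * w i by rewrite mul1r addrC.
  rewrite !(meval_eq _ (swap _ _)).
  move: x; apply: (cross_affine_eq0 q (mconj q) _ _ 1 1) => x x0.
  by rewrite -!(meval_eq _ (swap _ _)) crossH.
(* These solve [x + i y = u] and [x - i y = v], so every pair of points is reached. *)
move=> u v; pose x i := (u i + v i) / 2; pose y i := (u i - v i) / (2 * 'i%C).
have i0 : 'i%C != 0 :> C by rewrite eq_complex /= oner_eq0 andbF.
have yE i : 'i%C * y i = (u i - v i) / 2.
  by rewrite /y; field.
have uE i : x i + 'i%C * y i = u i by rewrite yE /x; field.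
have vE i : x i + - 'i%C * y i = v i by rewrite mulNr yE /x; field.
by have := cross x y; rewrite !(meval_eq _ uE) !(meval_eq _ vE).
Qed.

(** The cross identity is polynomial in [u] and in [v] separately: take the coefficient of [m] in
    [u], then that of [n] in [v]. *)
Lemma norm_conj_eq_coef q m n :
  (forall z, in_upper_half_space z -> `|(mconj q).@[z]| = `|q.@[z]|) ->
  q@_m * conjc q@_n = conjc q@_m * q@_n.
Proof.
move/norm_conj_eq_cross => cross.
have coef_v v : q@_m * (mconj q).@[v] = conjc q@_m * q.@[v].
  have E : (mconj q).@[v] *: q - q.@[v] *: mconj q = 0.
    apply: mpoly_eq0_pos => u _.
    by rewrite mevalB !mevalZ mulrC cross mulrC subrr.
  move/(congr1 (mcoeff m))/eqP: E.
  by rewrite mcoeffB !mcoeffZ mcoeff_mconj mcoeff0 subr_eq0 mulrC => /eqP ->; rewrite mulrC.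
have E : q@_m *: mconj q - conjc q@_m *: q = 0.
  by apply: mpoly_eq0_pos => v _; rewrite mevalB !mevalZ coef_v subrr.
move/(congr1 (mcoeff n))/eqP: E.
by rewrite mcoeffB !mcoeffZ mcoeff_mconj mcoeff0 subr_eq0 => /eqP.
Qed.

(** * Normalization of [P_M] and the order of [B] *)

Lemma mcoeff_mreal_part p m : (mreal_part p)@_m = (complex.Re p@_m)%:C%C.
Proof. by rewrite mcoeffZ mcoeffD mcoeff_mconj ReJ_add mulrC. Qed.

Lemma mcoeff_mimag_part p m : (mimag_part p)@_m = (complex.Im p@_m)%:C%C.
Proof.
have i0 : 'i%C != 0 :> C by rewrite eq_complex /= oner_eq0 andbF.
rewrite mcoeffZ mcoeffB mcoeff_mconj subcJ.
by rewrite mulrAC invfM; field.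
Qed.

Lemma pure_stableZ (c : C) p : c != 0 -> pure_stable p -> pure_stable (c *: p).
Proof.
move=> c0 [ps p_pure]; split=> [z /ps pz|q [r rE] [r' r'E]].
  by rewrite mevalZ mulf_neq0.
apply: p_pure; [exists (c^-1 *: r) | exists ((conjc c)^-1 *: r')].
  by rewrite -scalerAr -rE scalerA mulVf // scale1r.
by rewrite -scalerAr -r'E mconjZ scalerA mulVf ?conjc_eq0 // scale1r.
Qed.

(** All products [Q@_m * conjc Q@_n] are real, so the coefficients lie on one real line through 0;
    the conjugate phase of a nonzero one rotates that line onto the real axis. *)
Lemma lowest_part_unimodular_real p M :
  half_space_stable p -> vanishes_to_order p M ->
  exists2 c : C, `|c| = 1 & has_real_coefficients (homog_part M (c *: p)).
Proof.
move=> ps [p_lt]; set Q := homog_part M p => Q0.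
have cross m n : Q@_m * conjc Q@_n = conjc Q@_m * Q@_n.
  by apply: norm_conj_eq_coef => z; apply: lowest_part_norm_eq.
have [m Qm0] : exists m, Q@_m != 0.
  exists (mlead Q); by rewrite mleadc_eq0.
exists (conjc Q@_m / `|Q@_m|) => [|n].
  by rewrite normrM normcJ normfV normr_id divff ?normr_eq0.
apply/eqP/conjc_idP; rewrite homog_partZ mcoeffZ rmorphM fmorph_div.
have normJ : conjc `|Q@_m| = `|Q@_m| by rewrite normc_def; apply: conjc_real.
rewrite [X in X / _]conjcK [X in _ / X]normJ.
by rewrite mulrAC cross mulrAC.
Qed.

Lemma mconj_eq_of_lowest_parts p M :
  half_space_stable p -> vanishes_to_order p M ->
  has_real_coefficients (homog_part M p) ->
  has_real_coefficients (homog_part M.+1 p) -> mconj p = p.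
Proof.
move=> ps [p_lt Q0] Q_real Q1_real.
have real_at (y : 'I_d -> C) q : (forall i, 0 < y i) -> has_real_coefficients q ->
    complex.Im q.@[y] = 0.
  move=> y0 q_real; apply/eqP/conjc_idP; rewrite -[in RHS](_ : mconj q = q).
    rewrite meval_mconj; congr conjc; apply: meval_eq => i.
    by apply/esym/conjc_idP; have := y0 i; rewrite ltcE => /andP[].
  by apply/mpolyP => m; rewrite mcoeff_mconj; apply/conjc_idP; rewrite q_real.
(* The factor [P_M] covers the points [y] where [P_M(y) = 0]: there the coefficient of [t^M] in
   [p(t y)] is zero and the one-variable criterion does not apply. *)
have E : (mconj p - p) * homog_part M p = 0.
  apply: mpoly_eq0_pos => y y0; rewrite mevalM mevalB.
  have [->|Qy0] := eqVneq (homog_part M p).@[y] 0; first by rewrite mulr0.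
  pose f := mmap polyC (fun i => y i *: 'X) p : {poly C}.
  have fE j : f`_j = (homog_part j p).@[y] by apply: coef_mmap_line.
  have f_real : map_poly (@conjc R) f = f.
    apply: (half_plane_stable_real f M); rewrite ?fE ?real_at //.
      exact: mmap_line_stable.
    by move=> j /p_lt; rewrite fE => ->; rewrite meval0.
  have := congr1 (fun g : {poly C} => g.[1]) f_real.
  rewrite /= /f map_conjc_mmap !horner_mmap.
  have yE i : (y i *: 'X : {poly C}).[1] = y i by rewrite !hornerE.
  have yJE i : (map_poly (@conjc R) (y i *: 'X)).[1] = y i.
    rewrite map_polyZ map_polyX !hornerE /=.
    by apply/conjc_idP; have := y0 i; rewrite ltcE => /andP[].
  by rewrite (meval_eq _ yE) (meval_eq _ yJE) => ->; rewrite subrr mul0r.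
by move/eqP: E; rewrite mulf_eq0 (negPf Q0) orbF subr_eq0 => /eqP.
Qed.

(** Otherwise [p] divides both itself and its conjugate, hence is constant, hence 0 by its value at
    the origin, although it does not vanish at [(i, ..., i)]. *)
Lemma pure_stable_mconj_neq p : pure_stable p ->
  p.@[fun _ => 0] = 0 -> mconj p != p.
Proof.
move=> [ps p_pure] p0; apply/eqP => pJ.
have pp : mdivides p p by exists 1; rewrite mulr1.
have [|c pE] := p_pure p pp; first by rewrite pJ.
have := ps (fun=> 'i%C) (fun=> ltr01).
by move: p0; rewrite pE !mevalC => ->; rewrite eqxx.
Qed.

Lemma vanishes_to_order_mcoeff p M : vanishes_to_order p M ->
  forall m, (mdeg m < M)%N -> p@_m = 0.
Proof.
move=> [p_lt _] m mM.
by rewrite -[RHS](mcoeff0 _ m) -(p_lt _ mM) mcoeff_homog_part eqxx.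
Qed.
End Multivariate.

Theorem proposition2p5 (R : realType) (d : nat) (p : {mpoly R[i][d]}) (M : nat)
    (p_stable : pure_stable p)
    (p0 : p.@[fun _ : 'I_d => 0] = 0)
    (pM : vanishes_to_order p M) :
  (exists c : R[i], [/\ `|c| = 1, pure_stable (c *: p)
                      & has_real_coefficients (homog_part M (c *: p))]) /\
  (has_real_coefficients (homog_part M p) ->
     is_lowest_term (mreal_part p) (homog_part M p) /\
     vanishes_to_order (mimag_part p) M.+1).
Proof.
split.
  have [c c1 c_real] := lowest_part_unimodular_real p M p_stable.1 pM.
  exists c; split=> //; apply: pure_stableZ => //.
  by rewrite -normr_gt0 c1 ltr01.
move=> Q_real; have p_lt := vanishes_to_order_mcoeff p M pM.
have p_real n : mdeg n = M -> complex.Im p@_n = 0.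
  by move=> nM; have := Q_real n; rewrite mcoeff_homog_part nM eqxx.
have A_part : homog_part M p = homog_part M (mreal_part p).
  apply/mpolyP => n; rewrite !mcoeff_homog_part; case: eqP => // /p_real n_real.
  by rewrite mcoeff_mreal_part; case: p@_n n_real => a b /= ->.
split.
  exists M; split=> //; split; last by rewrite -A_part; case: pM.
  move=> j jM; apply/mpolyP => n; rewrite mcoeff_homog_part mcoeff0.
  by case: eqP => // nj; rewrite mcoeff_mreal_part p_lt ?nj.
split.
  (* The degrees below [M.+1] split into [M], where [P_M] is real, and those in which [p] itself has
     no terms. *)
  move=> j; rewrite ltnS leq_eqVlt => jM.
  apply/mpolyP => n; rewrite mcoeff_homog_part mcoeff0.
  case: eqP => // nj; rewrite mcoeff_mimag_part; case/predU1P: jM => [jM|jM].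
    by rewrite p_real // nj.
  by rewrite p_lt ?nj.
(* If the part of [B] of degree [M.+1] were zero, [P_(M+1)] would be real along with [P_M], which
   forces [mconj p = p]. *)
apply: contra (pure_stable_mconj_neq p p_stable p0) => /eqP B0.
apply/eqP/(mconj_eq_of_lowest_parts p M) => //; first exact: p_stable.1.
move=> n; rewrite mcoeff_homog_part; case: eqP => // nM.
move/(congr1 (mcoeff n)): B0; rewrite mcoeff_homog_part nM eqxx mcoeff0.
by rewrite mcoeff_mimag_part => -[].
Qed.
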